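(* Let $t\ge 1$ and let $s_1, s_2, \dots, s_t$ be integers with $s_i\ge 3$ for all $i$. Then $$gr(K_{2s_1-1}^{(3)}-e, K_{2s_2-1}^{(3)}-e, \dots, K_{2s_t-1}^{(3)}-e;3)\ge gr(K_{s_1}^{(2)}, K_{s_2}^{(2)}, \dots, K_{s_t}^{(2)};2).$$
   Context: An $r$-uniform hypergraph $H=(V,E)$ consists of a nonempty finite set $V$ of vertices and a set $E$ of hyperedges, which are (distinct) $r$-element subsets of $V$; for $r=2$ this is a simple graph. $K_n^{(r)}$ denotes the complete $r$-uniform hypergraph of order $n$ (every $r$-element subset of the vertex set is a hyperedge), and $K_n^{(r)}-e$ denotes $K_n^{(r)}$ with a single hyperedge removed. A $t$-coloring of an $r$-uniform hypergraph $H$ is a function $E(H)\to\{1,2,\dots,t\}$. A hypergraph is rainbow under a coloring if all of its hyperedges receive pairwise distinct colors. A Gallai $t$-coloring of $K_n^{(r)}$ is a $t$-coloring that contains no rainbow subhypergraph isomorphic to $K_{r+1}^{(r)}$ (for $r=2$: no rainbow triangle; for $r=3$: no rainbow $K_4^{(3)}$). For $r$-uniform hypergraphs $H_1,\dots,H_t$, the Gallai-Ramsey number $gr(H_1,\dots,H_t;r)$ is the least natural number $p$ such that every Gallai $t$-coloring of $K_p^{(r)}$ contains, for some $i\in\{1,\dots,t\}$, a (not necessarily induced) subhypergraph isomorphic to $H_i$ all of whose hyperedges have color $i$. *)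

(* Defs.v *)
(* MathComp world. *)
From mathcomp Require Import all_boot.

Set Implicit Arguments.
Unset Strict Implicit.
Unset Printing Implicit Defensive.

(* The vertex type may be empty, so that the complete hypergraph of order 0
   exists.  See gr_gt0 for why this does not affect Gallai-Ramsey numbers of
   hypergraphs with vertices. *)
Record hypergraph (r : nat) := Hypergraph {
  vertex : finType;
  edges : {set {set vertex}};
  edges_uniform : {in edges, forall e : {set vertex}, #|e| = r} }.

Definition hyperedge (r : nat) (H : hypergraph r) :=
  {e : {set vertex H} | e \in edges H}.

Lemma complete_uniform (r n : nat) :
  {in [set e : {set 'I_n} | #|e| == r], forall e : {set 'I_n}, #|e| = r}.
Proof. by move=> e; rewrite inE => /eqP. Qed.

Definition complete (r n : nat) : hypergraph r :=
  Hypergraph (@complete_uniform r n).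

Lemma delete_edge_uniform (r : nat) (H : hypergraph r) (e : hyperedge H) :
  {in edges H :\ val e, forall e' : {set vertex H}, #|e'| = r}.
Proof. by move=> e' /setD1P[_ /edges_uniform]. Qed.

Definition delete_edge (r : nat) (H : hypergraph r) (e : hyperedge H) :
  hypergraph r := Hypergraph (@delete_edge_uniform r H e).

Definition coloring (r : nat) (H : hypergraph r) (t : nat) :=
  {ffun hyperedge H -> 'I_t}.

(* A subhypergraph is given by its vertex set W and its hyperedge set F. *)
Definition subhypergraph (r : nat) (H : hypergraph r)
    (W : {set vertex H}) (F : {set {set vertex H}}) : bool :=
  (F \subset edges H) && [forall e in F, e \subset W].

(* (W, F) is isomorphic to H': a bijection f from the vertices of H' onto W
   carries the hyperedges of H' exactly onto F. *)
Definition iso_to (r : nat) (H : hypergraph r)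
    (W : {set vertex H}) (F : {set {set vertex H}}) (H' : hypergraph r) : bool :=
  [exists f : {ffun vertex H' -> vertex H},
    [&& injectiveb f, f @: [set: vertex H'] == W
      & [set f @: (e : {set vertex H'}) | e in edges H'] == F]].

Definition rainbow (r : nat) (H : hypergraph r) (t : nat)
    (c : coloring H t) (F : {set {set vertex H}}) : bool :=
  [forall e : hyperedge H, forall e' : hyperedge H,
    [&& val e \in F, val e' \in F & c e == c e'] ==> (e == e')].

Definition monochromatic (r : nat) (H : hypergraph r) (t : nat)
    (c : coloring H t) (F : {set {set vertex H}}) (i : 'I_t) : bool :=
  [forall e : hyperedge H, (val e \in F) ==> (c e == i)].

Definition gallai (r : nat) (H : hypergraph r) (t : nat)
    (c : coloring H t) : bool :=
  ~~ [exists W : {set vertex H}, exists F : {set {set vertex H}},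
       [&& subhypergraph W F, iso_to W F (complete r r.+1) & rainbow c F]].

Definition has_mono_copy (r : nat) (H : hypergraph r) (t : nat)
    (c : coloring H t) (H' : hypergraph r) (i : 'I_t) : bool :=
  [exists W : {set vertex H}, exists F : {set {set vertex H}},
    [&& subhypergraph W F, iso_to W F H' & monochromatic c F i]].

Definition gallai_ramsey (r t : nat) (H : 'I_t -> hypergraph r) (p : nat) : bool :=
  [forall c : coloring (complete r p) t,
    gallai c ==> [exists i : 'I_t, has_mono_copy c (H i) i]].

(* Ramsey's theorem for r-subsets, which shows that the least natural number
   in the definition of gr exists. *)
Lemma ramsey (r t : nat) (m : 'I_t -> nat) : exists N : nat,
  forall (T : finType) (A : {set T}) (c : {set T} -> 'I_t), N <= #|A| ->
  exists (i : 'I_t) (W : {set T}), [/\ W \subset A, #|W| = m i &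
    forall e : {set T}, e \subset W -> #|e| = r -> c e = i].
Proof.
elim: r t m => [|r IHr] t m.
  exists (\max_i m i) => T A c leA.
  have [W] : exists W : {set T}, W \subset A /\ #|W| = m (c set0).
    have: 0 < #|[set W : {set T} | W \subset A & #|W| == m (c set0)]|.
      by rewrite cards_draws bin_gt0 (leq_trans _ leA) // leq_bigmax.
    by case/card_gt0P=> W; rewrite inE => /andP[sWA /eqP cW]; exists W.
  case=> sWA cW; exists (c set0), W; split=> // e _ /eqP.
  by rewrite cards_eq0 => /eqP->.
move: {2}(\sum_i m i) (leqnn (\sum_i m i)) => k.
elim: k m => [|k IHk] m lek.
  exists 0 => T A c _; exists (c set0), set0; split; first exact: sub0set.
    move: lek; rewrite leqn0 sum_nat_eq0 => /forallP/(_ (c set0))/eqP->.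
    by rewrite cards0.
  by move=> e; rewrite subset0 => /eqP->; rewrite cards0.
have [/existsP[i0 /eqP mi0]|m_gt0] := boolP [exists i, m i == 0].
  exists 0 => T A c _; exists i0, set0; split; first exact: sub0set.
    by rewrite mi0 cards0.
  by move=> e; rewrite subset0 => /eqP->; rewrite cards0.
have {}m_gt0 i : 0 < m i.
  by rewrite lt0n; apply: contra m_gt0 => mi; apply/existsP; exists i.
pose m' i j := if j == i then (m j).-1 else m j.
have N'P i : exists N : nat,
  forall (T : finType) (A : {set T}) (c : {set T} -> 'I_t), N <= #|A| ->
  exists (j : 'I_t) (W : {set T}), [/\ W \subset A, #|W| = m' i j &
    forall e : {set T}, e \subset W -> #|e| = r.+1 -> c e = j].
  apply: IHk; rewrite -ltnS; apply: leq_trans lek.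
  rewrite (bigD1 i) //= [X in _ < X](bigD1 i) //= {1}/m' eqxx.
  rewrite (eq_bigr m) => [|j /negPf ji]; last by rewrite /m' ji.
  by rewrite ltn_add2r prednK.
have [N' {}N'P] := fin_all_exists N'P.
have [N NP] := IHr t (fun _ => \max_i N' i).
exists N.+1 => T A c ltA.
have [x Ax] : exists x, x \in A by apply/card_gt0P; apply: leq_trans ltA.
have [|i [B [sBA cB cBi]]] := NP T (A :\ x) (fun e => c (x |: e)).
  by move: ltA; rewrite (cardsD1 x A) Ax.
have [|j [W [sWB cW Wj]]] := N'P i T B c; first by rewrite cB leq_bigmax.
have sWA : W \subset A :\ x := subset_trans sWB sBA.
have sWA' := subset_trans sWA (subsetDl _ _).
have xW : x \notin W by apply/negP=> /(subsetP sWA); rewrite !inE eqxx.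
have [ji|ji] := eqVneq j i; last first.
  by exists j, W; split=> //; rewrite cW /m' (negPf ji).
subst j; exists i, (x |: W); split.
- by rewrite subUset sub1set Ax.
- by rewrite cardsU1 xW cW /m' eqxx add1n prednK.
move=> e sexW ce; have [xe|xe] := boolP (x \in e); last first.
  apply: Wj => //; apply/subsetP=> y ye.
  have /setU1P[yx|//] := subsetP sexW y ye.
  by rewrite -yx ye in xe.
rewrite -(setD1K xe); apply: cBi; last first.
  by move: ce; rewrite (cardsD1 x e) xe => -[].
apply: subset_trans sWB; apply/subsetP=> y /setD1P[yx /(subsetP sexW)].
by rewrite !inE (negPf yx).
Qed.

Lemma gallai_ramsey_exists (r t : nat) (H : 'I_t -> hypergraph r) :
  exists p : nat, gallai_ramsey H p.
Proof.
have [N NP] := ramsey r (fun i => #|vertex (H i)|).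
exists (maxn N r); apply/forallP=> c; apply/implyP=> _.
have [e0 e0E] : exists e, e \in edges (complete r (maxn N r)).
  apply/card_gt0P.
  by rewrite card_draws bin_gt0 card_ord leq_maxr.
have [|i [W [_ cW Wi]]] :=
    NP _ [set: 'I_(maxn N r)] (fun e => c (insubd (exist _ e0 e0E) e)).
  by rewrite cardsT card_ord leq_maxl.
pose f := [ffun x : vertex (H i) => enum_val (cast_ord (esym cW) (enum_rank x))].
have f_inj : injective f.
  by move=> x y; rewrite !ffunE => /enum_val_inj/cast_ord_inj/enum_rank_inj.
have fW x : f x \in W by rewrite ffunE enum_valP.
have sfW (e : {set _}) : f @: e \subset W.
  by apply/subsetP=> _ /imsetP[x _ ->].
apply/existsP; exists i; apply/existsP; exists (f @: setT); apply/existsP.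
exists [set f @: (e : {set vertex (H i)}) | e in edges (H i)].
apply/and3P; split.
- apply/andP; split.
    apply/subsetP=> _ /imsetP[e eE ->].
    by rewrite inE card_imset // (edges_uniform eE).
  by apply/forall_inP=> _ /imsetP[e eE ->]; rewrite imsetS ?subsetT.
- by apply/existsP; exists f; rewrite !eqxx !andbT; apply/injectiveP.
apply/forallP=> e; apply/implyP=> /imsetP[e' e'E def_e].
rewrite -(Wi (val e)) ?def_e ?sfW ?card_imset ?(edges_uniform e'E) //.
by rewrite -def_e valKd.
Qed.

Definition gr (r t : nat) (H : 'I_t -> hypergraph r) : nat :=
  ex_minn (gallai_ramsey_exists H).

Lemma gr_gt0 (r t : nat) (H : 'I_t -> hypergraph r) : 0 < r ->
  (forall i, 0 < #|vertex (H i)|) -> 0 < t -> 0 < gr H.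
Proof.
move=> r_gt0 H_gt0 t_gt0; rewrite /gr; case: ex_minnP => -[|//] /forallP gr0 _.
pose c : coloring (complete r 0) t := [ffun=> Ordinal t_gt0].
have /implyP/(_ _)/existsP[|i] := gr0 c.
  apply/negP=> /existsP[W /existsP[F /and3P[_ /existsP[f _] _]]].
  by case: (f ord0).
case/existsP=> W /existsP[F /and3P[_ /existsP[f _] _]].
by have /card_gt0P[x _] := H_gt0 i; case: (f x).
Qed.

(* Main.v *)
Require Import Defs.
From mathcomp Require Import all_boot.

(** An [r]-uniform coloring [c] of the complete hypergraph on the ordered vertex
    set ['I_p] lifts to an [r.+1]-uniform one: delete the largest vertex of a
    hyperedge and take the color [c] gives to the rest.

    - The lift is a Gallai coloring whatever [c] is ([gallai_lift]): among
      [r.+2] vertices, the [r] smallest ones together with either of the two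
      largest ones form two hyperedges of the same color.
    - If the lift has a copy of a complete hypergraph minus one hyperedge on at
      least [n + 2] vertices in color [i], then [c] is constantly [i] on the [n]
      smallest vertices of the copy ([lift_mono_copy]): an [r]-subset of them is
      extended to an [r.+1]-subset by each of at least two larger vertices, and
      only one of these extensions can be the deleted hyperedge.

    Hence an order that forces a monochromatic copy in Gallai [r.+1]-uniform
    colorings also forces one in all [r]-uniform colorings ([gallai_ramsey_lift]).
    For [r = 2] and copies on [2 * s - 1] vertices, the room needed is
    [s + 2 <= 2 * s - 1], which is [3 <= s]. *)

Set Implicit Arguments.
Unset Strict Implicit.
Unset Printing Implicit Defensive.

Lemma lower_part (p k : nat) (V : {set 'I_p}) : k <= #|V| ->
  exists S : {set 'I_p}, [/\ S \subset V, #|S| = k &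
    forall x y, x \in S -> y \in V :\: S -> x < y].
Proof.
elim: k => [|k IHk] lekV.
  by exists set0; split; rewrite ?sub0set ?cards0 // => x y; rewrite inE.
have [S [sSV cS ltS]] := IHk (ltnW lekV).
have [x0 x0VS] : exists x, x \in V :\: S.
  by apply/card_gt0P; rewrite cardsDS // cS subn_gt0.
have [x xVS min_x] := arg_minnP (fun y : 'I_p => y : nat) x0VS.
have /setDP[xV xS] := xVS.
exists (x |: S); split; first by rewrite subUset sub1set xV.
  by rewrite cardsU1 xS cS.
move=> a b /setU1P aS /setDP[bV]; rewrite in_setU1 negb_or => /andP[bx bS].
have bVS : b \in V :\: S by rewrite inE bS.
case: aS => [->|aS]; last exact: ltS.
by rewrite ltn_neqAle eq_sym bx min_x.
Qed.

(** The maximum is removed as the only element of [A] with nothing above it, so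
    the empty set, which has no maximum, needs no special treatment. *)
Definition del_max (p : nat) (A : {set 'I_p}) : {set 'I_p} :=
  [set x in A | [exists y in A, x < y]].

Lemma del_maxU1 (p : nat) (B : {set 'I_p}) (x : 'I_p) :
  (forall b, b \in B -> b < x) -> del_max (x |: B) = B.
Proof.
move=> ltBx; apply/setP=> z; rewrite !inE.
apply/andP/idP => [[/orP[/eqP->|//]]|zB].
  case/exists_inP=> y /setU1P[->|/ltBx]; first by rewrite ltnn.
  by move=> /ltnW; rewrite leqNgt => /negP.
split; first by rewrite zB orbT.
by apply/exists_inP; exists x; rewrite ?setU11 ?ltBx.
Qed.

Lemma card_del_max (p r : nat) (A : {set 'I_p}) : #|A| = r.+1 -> #|del_max A| = r.
Proof.
move=> cA; have [|B [sBA cB ltB]] := @lower_part p r A; first by rewrite cA.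
have /eqP/cards1P[x defx] : #|A :\: B| = 1 by rewrite cardsDS // cA cB subSnn.
have -> : A = x |: B by rewrite -(setID A B) defx (setIidPr sBA) setUC.
by rewrite del_maxU1 // => b bB; apply: ltB; rewrite // defx set11.
Qed.

Lemma mem_complete (r p : nat) (A : {set 'I_p}) :
  #|A| = r -> A \in edges (complete r p).
Proof. by move=> cA; rewrite inE cA. Qed.

Definition complete_edge (r p : nat) (A : {set 'I_p}) (cA : #|A| = r) :
  hyperedge (complete r p) :=
  exist (fun B : {set 'I_p} => B \in edges (complete r p)) A (mem_complete cA).

Definition del_max_edge (p r : nat) (e : hyperedge (complete r.+1 p)) :
  hyperedge (complete r p) :=
  complete_edge (card_del_max (edges_uniform (valP e))).

Definition lift (p r t : nat) (c : coloring (complete r p) t) :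
  coloring (complete r.+1 p) t := [ffun e => c (del_max_edge e)].

Lemma lift_eq (p r t : nat) (c : coloring (complete r p) t)
    (e : hyperedge (complete r.+1 p)) (b : hyperedge (complete r p)) (x : 'I_p) :
  val e = x |: val b -> (forall y, y \in val b -> y < x) -> lift c e = c b.
Proof.
move=> def_e ltx; rewrite ffunE; congr (c _); apply: val_inj.
by rewrite /= def_e del_maxU1.
Qed.

Lemma iso_to_card (r : nat) (H H' : hypergraph r) (W : {set vertex H})
    (F : {set {set vertex H}}) : iso_to W F H' -> #|W| = #|vertex H'|.
Proof.
case/existsP=> f /and3P[/injectiveP f_inj /eqP<- _].
by rewrite card_imset // cardsT.
Qed.

Lemma iso_to_complete (r n : nat) (H : hypergraph r) (W : {set vertex H})
    (F : {set {set vertex H}}) (A : {set vertex H}) :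
  iso_to W F (complete r n) -> A \subset W -> #|A| = r -> A \in F.
Proof.
case/existsP=> f /and3P[/injectiveP f_inj /eqP<- /eqP<-] sAW cA.
have defA : A = f @: (f @^-1: A).
  apply/setP=> y; apply/idP/imsetP=> [yA|[x]]; last by rewrite inE => ? ->.
  by have /imsetP[x _ def_y] := subsetP sAW y yA; exists x; rewrite // inE -def_y.
by rewrite defA imset_f // inE -(card_imset _ f_inj) -defA cA.
Qed.

(** The image [e0] of the deleted hyperedge is put back, so that
    [iso_to_complete] also applies to copies of complete hypergraphs minus a
    hyperedge. *)
Lemma iso_to_delete_edge (r : nat) (H H' : hypergraph r) (e : hyperedge H')
    (W : {set vertex H}) (F : {set {set vertex H}}) :
  iso_to W F (delete_edge e) ->
  exists e0 : {set vertex H}, iso_to W (e0 |: F) H'.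
Proof.
case/existsP=> f /and3P[f_inj fW /eqP<-]; exists (f @: val e).
apply/existsP; exists f; rewrite f_inj fW /=; apply/eqP.
by rewrite -[in LHS](setD1K (valP e)) imsetU1.
Qed.

Lemma complete_iso_to (r n : nat) (H : hypergraph r) (W : {set vertex H}) :
  #|W| = n ->
  iso_to W [set A : {set vertex H} | A \subset W & #|A| == r] (complete r n).
Proof.
move=> cW; pose f := [ffun x : 'I_n => enum_val (cast_ord (esym cW) x)].
have f_inj : injective f.
  by move=> x y; rewrite !ffunE => /enum_val_inj/cast_ord_inj.
have defW : f @: [set: 'I_n] = W.
  apply/eqP; rewrite eqEcard card_imset // cardsT card_ord cW leqnn andbT.
  by apply/subsetP=> _ /imsetP[x _ ->]; rewrite ffunE enum_valP.
have iso : iso_to W [set f @: (e : {set 'I_n}) | e in edges (complete r n)]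
             (complete r n).
  by apply/existsP; exists f; rewrite defW !eqxx !andbT; apply/injectiveP.
suff <- : [set f @: (e : {set 'I_n}) | e in edges (complete r n)] =
          [set A : {set vertex H} | A \subset W & #|A| == r] by [].
apply/setP=> A; rewrite inE; apply/idP/andP=> [|[sAW /eqP cA]]; last first.
  exact: (iso_to_complete iso).
case/imsetP=> e; rewrite inE => /eqP ce ->.
by rewrite card_imset // ce -defW imsetS ?subsetT.
Qed.

(** A copy of the complete hypergraph of order [r.+2] contains [x |: B] and
    [y |: B], where [B] consists of its [r] smallest vertices and [x] and [y]
    are the other two; both lose [x], resp. [y], and get the color of [B]. *)
Lemma gallai_lift (p r t : nat) (c : coloring (complete r p) t) :
  gallai (lift c).
Proof.
apply/negP=> /existsP[W /existsP[F /and3P[_ isoF rbF]]].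
have cW := iso_to_card isoF; rewrite card_ord in cW.
have [|B [sBW cB ltB]] := @lower_part p r W; first by rewrite cW -addn2 leq_addr.
have /eqP/cards2P[x [y [xy defxy]]] : #|W :\: B| = 2.
  by rewrite cardsDS // cW cB subSn ?leqnSn // subSnn.
have ext z : z \in [set x; y] -> exists e : hyperedge (complete r.+1 p),
    [/\ val e = z |: B, val e \in F & lift c e = c (complete_edge cB)].
  rewrite -defxy => zW; have /setDP[zW' zB] := zW.
  have cz : #|z |: B| = r.+1 by rewrite cardsU1 zB cB.
  exists (complete_edge cz); split=> //=.
    by apply: (iso_to_complete isoF); rewrite // subUset sub1set zW'.
  by apply: (@lift_eq _ _ _ _ _ _ z) => //= b bB; apply: ltB.
have [e [def_e eF ce]] := ext x (set21 x y).
have [e' [def_e' e'F ce']] := ext y (set22 x y).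
have /forallP/(_ e')/implyP := forallP rbF e.
rewrite eF e'F ce ce' eqxx => /(_ isT)/eqP ee'.
have : x \in y |: B by rewrite -def_e' -ee' def_e setU11.
have /setDP[_ xB] : x \in W :\: B by rewrite defxy set21.
by rewrite in_setU1 (negPf xy) (negPf xB).
Qed.

(** The clique for [c] is the set [S] of the [n] smallest vertices of the copy.
    An [r]-subset [b] of [S] has the color of [z |: b] for each vertex [z] of the
    copy above [S]; the margin [2] leaves a choice of [z] that avoids the deleted
    hyperedge. *)
Lemma lift_mono_copy (p r t n m : nat) (c : coloring (complete r p) t)
    (e : hyperedge (complete r.+1 m)) (i : 'I_t) : n + 2 <= m ->
  has_mono_copy (lift c) (delete_edge e) i -> has_mono_copy c (complete r n) i.
Proof.
move=> lenm /existsP[V /existsP[F /and3P[_ /iso_to_delete_edge[e0 isoF] monoF]]].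
have cV := iso_to_card isoF; rewrite card_ord in cV.
have [|S [sSV cS ltS]] := @lower_part p n V.
  by rewrite cV (leq_trans _ lenm) ?leq_addr.
apply/existsP; exists S; apply/existsP.
exists [set A : {set 'I_p} | A \subset S & #|A| == r].
rewrite (@complete_iso_to r n (complete r p)) //; apply/and3P; split=> //.
  apply/andP; split; first by apply/subsetP=> A; rewrite !inE => /andP[].
  by apply/forall_inP=> A; rewrite inE => /andP[].
apply/forallP=> b; apply/implyP; rewrite inE => /andP[sbS /eqP cb].
have /card_gt1P[x [y [xVS yVS xy]]] : 1 < #|V :\: S|.
  by rewrite cardsDS // cV cS ltn_subRL (leq_trans _ lenm) // addnC addn2.
have notin z : z \in V :\: S -> z \notin val b.
  by case/setDP=> _; apply: contra; apply: subsetP.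
(* [x |: b] and [y |: b] differ, so one of them is not the hyperedge [e0]
   that the copy may lack. *)
have [z zVS ze0] : exists2 z, z \in V :\: S & z |: val b != e0.
  have [xe0|] := eqVneq (x |: val b) e0; last by exists x.
  exists y => //; apply: contra xy => /eqP ye0.
  have : x \in y |: val b by rewrite ye0 -xe0 setU11.
  by rewrite in_setU1 (negPf (notin x xVS)) orbF.
have cz : #|z |: val b| = r.+1 by rewrite cardsU1 notin // cb.
have zF : z |: val b \in F.
  have: z |: val b \in e0 |: F.
    apply: (iso_to_complete isoF) => //.
    by rewrite subUset sub1set (subset_trans sbS) // andbT; case/setDP: zVS.
  by rewrite in_setU1 (negPf ze0).
have /implyP/(_ zF)/eqP <- := forallP monoF (complete_edge cz).
rewrite (@lift_eq _ _ _ c _ b z) // => a ab.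
by apply: ltS => //; apply: (subsetP sbS).
Qed.

(** The hypothesis speaks of Gallai colorings only, but lifts are always Gallai,
    so it applies to the lift of every [c]. *)
Lemma gallai_ramsey_lift (p r t : nat) (n m : 'I_t -> nat)
    (e : forall i, hyperedge (complete r.+1 (m i))) :
  (forall i, n i + 2 <= m i) ->
  gallai_ramsey (fun i => delete_edge (e i)) p ->
  gallai_ramsey (fun i => complete r (n i)) p.
Proof.
move=> lenm /forallP ramseyp; apply/forallP=> c; apply/implyP=> _.
have /existsP[i copy_i] := implyP (ramseyp (lift c)) (gallai_lift c).
by apply/existsP; exists i; apply: lift_mono_copy copy_i.
Qed.

Theorem theorem3 (t : nat) (s : 'I_t -> nat) (t_ge1 : 1 <= t)
    (s_ge3 : forall i : 'I_t, 3 <= s i)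
    (e : forall i : 'I_t, hyperedge (complete 3 (2 * s i - 1))) :
  gr (fun i : 'I_t => delete_edge (e i)) >= gr (fun i : 'I_t => complete 2 (s i)).
Proof.
rewrite {2}/gr; case: ex_minnP => p ramseyp _.
rewrite /gr; case: ex_minnP => q _; apply; apply: gallai_ramsey_lift ramseyp.
by move=> i; rewrite mul2n -addnn -addnBA ?leq_add2l ?leq_subRL ?(ltnW (ltnW (s_ge3 i))).
Qed.
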